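(* Let $\Xi$ be a nonnegative integer-valued random variable. Suppose that one of the following alternatives holds: \begin{itemize} \item $\mathcal{G}=\mathbb{Z}$ and $\mathbf{E}\sqrt{\Xi}<\infty$; \item $\mathcal{G}=\mathbb{Z}^2$ and $\mathbf{E}\,\frac{\Xi}{\log(\Xi\vee 2)}<\infty$; \item $\mathcal{G}=\mathbb{T}_d$ or $\mathcal{G}=\mathbb{Z}^d$ for some $d\ge 3$, and $\mathbf{E}\,\Xi<\infty$. \end{itemize} Then $\mathrm{FM}(\mathcal{G},\Xi)$ is transient.
   Context: Here $a\vee b=\max\{a,b\}$; $\mathbb{Z}^d$ denotes the graph with vertex set $\mathbb{Z}^d$ and edges between points at $\ell^1$-distance $1$, with root $\mathbf{0}$ the origin; $\mathbb{T}_d$ ($d\ge3$) denotes the infinite homogeneous tree in which every vertex has degree $d$, with a fixed root $\mathbf{0}$. Frog model $\mathrm{FM}(\mathcal{G},\Xi)$ with general lifetimes. Initially there is exactly one particle at each site (vertex) of $\mathcal{G}$; at time $0$ all particles are sleeping except the one at the root $\mathbf{0}$, which is active. Let $(\Xi^x)_{x\in\mathcal{G}}$ be i.i.d. random variables with the law of $\Xi$, and, independently of them, let $(S^x_n)_{n\ge0}$, $x\in\mathcal{G}$, be independent discrete-time simple random walks on $\mathcal{G}$, $S^x$ starting from $x$. If the particle of site $x$ is activated at time $T(x)$, it is active and located at $S^x_n$ at time $T(x)+n$ for $0\le n<\Xi^x$, and then disappears. When an active particle visits a site, the sleeping particle there (if any) becomes active. Formally, $t(x,y)=\min\{n<\Xi^x:S^x_n=y\}$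 for $x\neq y$ ($\infty$ if there is no such $n$), and $T(x)=\inf\{t(x_0,x_1)+\dots+t(x_{m-1},x_m)\}$ over all finite sequences $\mathbf{0}=x_0,x_1,\dots,x_m=x$, with $T(\mathbf{0})=0$; $T(x)=\infty$ means that $x$ is never visited by active particles. The root is hit infinitely often if there are infinitely many times at which some active particle is located at $\mathbf{0}$. The model is called recurrent if $\mathbf{P}[\mathbf{0}\text{ is hit infinitely often}]>0$, and transient otherwise. *)

(* Defs.v *)
From mathcomp Require Import all_boot all_order all_algebra finmap.
From mathcomp Require Import all_classical all_reals all_analysis.

Set Implicit Arguments.
Unset Strict Implicit.
Unset Printing Implicit Defensive.

Import Order.TTheory GRing.Theory Num.Theory.

Local Open Scope classical_set_scope.
Local Open Scope ring_scope.

Record rooted_graph := RootedGraph {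
  vertex :> countType;
  adj : rel vertex;
  root : vertex;
  adj_sym : symmetric adj;
  adj_irr : irreflexive adj }.

Arguments adj {r}.
Arguments root {r}.

Definition neighbors (G : rooted_graph) (x : G) : set G := [set y | adj x y].

Definition degree (G : rooted_graph) (x : G) : nat :=
  #|` fset_set (neighbors x) |.

Definition lattice_adj (d : nat) : rel 'rV[int]_d :=
  fun x y => \sum_(i < d) `|x ord0 i - y ord0 i| == 1.

Lemma lattice_adj_sym d : symmetric (@lattice_adj d).
Proof.
move=> x y; rewrite /lattice_adj; congr (_ == _).
by apply: eq_bigr => i _; rewrite distrC.
Qed.

Lemma lattice_adj_irr d : irreflexive (@lattice_adj d).
Proof.
by move=> x; rewrite /lattice_adj big1 // => i _; rewrite subrr normr0.
Qed.

Definition Zlattice (d : nat) : rooted_graph :=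
  @RootedGraph 'rV[int]_d (@lattice_adj d) 0
    (@lattice_adj_sym d) (@lattice_adj_irr d).

Definition connected_graph (G : rooted_graph) : Prop :=
  forall x y : G, exists p : seq G, path adj x p /\ last x p = y.

(* [ucycle] also holds of the empty sequence and of the two ends of an edge,
   neither of which is a cycle in the sense of graph theory. *)
Definition acyclic_graph (G : rooted_graph) : Prop :=
  forall c : seq G, ucycle adj c -> (size c <= 2)%N.

(* This determines the rooted graph T_d up to isomorphism. *)
Definition homogeneous_tree (d : nat) (G : rooted_graph) : Prop :=
  [/\ connected_graph G, acyclic_graph G &
      forall x : G, finite_set (neighbors x) /\ degree x = d].

Section Probability.
Context d (Om : measurableType d) (R : realType) (P : probability Om R).

Definition mutually_independent (I : choiceType) (F : I -> set (set Om)) :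
    Prop :=
  forall (J : {fset I}) (A : I -> set Om), (forall i, i \in J -> F i (A i)) ->
  (P (\bigcap_(i in [set` J]) A i) = \prod_(i <- J) P (A i))%E.

Definition independent2 (F1 F2 : set (set Om)) : Prop :=
  forall A B : set Om, F1 A -> F2 B -> (P (A `&` B) = P A * P B)%E.

(* The sigma-algebra generated by the functions X i, where V carries the
   discrete sigma-algebra. *)
Definition sigma_gen (I V : Type) (X : I -> Om -> V) : set (set Om) :=
  <<s \bigcup_i preimage_set_system setT (X i) [set: set V] >>.

Section Walk.
Variable G : rooted_graph.

Definition srw_step (x y : G) : R :=
  if adj x y then (degree x)%:R^-1 else 0.

Record simple_random_walk (x : G) (S : nat -> Om -> G) : Prop := {
  srw_measurable : forall n (B : set G), measurable (S n @^-1` B);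
  srw_start : P (S 0%N @^-1` [set x]) = 1%E;
  srw_markov : forall n (y : nat -> G),
    (P [set w | forall i, (i <= n.+1)%N -> S i w = y i]
     = P [set w | forall i, (i <= n)%N -> S i w = y i]
       * (srw_step (y n) (y n.+1))%:E)%E }.

End Walk.
End Probability.

Section FrogModel.
Context (R : realType) (G : rooted_graph).
Context d0 (Om0 : measurableType d0) (P0 : probability Om0 R)
  (Xi : {RV P0 >-> nat}).
Context d (Om : measurableType d) (P : probability Om R).
Variables (L : G -> {RV P >-> nat}) (S : G -> nat -> Om -> G).

(* (Om, P) carries the lifetimes L x, i.i.d. with the law of Xi, and, independent
   of them, the independent simple random walks S x. *)
Record frog_model : Prop := {
  lifetime_law : forall x, distribution P (L x) =1 distribution P0 Xi;
  lifetime_indep : mutually_independent P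
    (fun x => sigma_gen (fun _ : unit => L x : Om -> nat));
  walk_srw : forall x, simple_random_walk P x (S x);
  walk_indep : mutually_independent P (fun x => sigma_gen (S x));
  lifetime_walk_indep : independent2 P
    (sigma_gen (fun x => L x : Om -> nat))
    (sigma_gen (fun xn : G * nat => S xn.1 xn.2)) }.

Local Open Scope ereal_scope.

Definition hitting_time (w : Om) (x y : G) : \bar R :=
  ereal_inf [set n%:R%:E | n in [set n | (n < L x w)%N /\ S x n w = y]].

(* t(x, x_1) + t(x_1, x_2) + ... along p = [:: x_1; x_2; ...]. *)
Fixpoint passage_time (w : Om) (x : G) (p : seq G) : \bar R :=
  if p is y :: p' then hitting_time w x y + passage_time w y p' else 0.

(* Only t(x, y) with x <> y occurs in the model; since hitting_time is
   nonnegative, repetitions in p do not lower the infimum. *)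
Definition activation_time (w : Om) (x : G) : \bar R :=
  ereal_inf [set passage_time w root p | p in [set p | last root p = x]].

Definition active_at (w : Om) (k : nat) (y : G) : Prop :=
  exists x n, [/\ (n < L x w)%N,
    activation_time w x + n%:R%:E = k%:R%:E & S x n w = y].

Definition root_hit_infinitely_often : set Om :=
  [set w | infinite_set [set k | active_at w k root]].

Definition recurrent : Prop := 0 < P root_hit_infinitely_often.

Definition transient : Prop := ~ recurrent.

End FrogModel.

(* Main.v *)
(* If the root is hit at infinitely many times then infinitely many particles
   have a walk that meets the root within its lifetime, because a single
   particle lives for a finite time.  By the Borel-Cantelli lemma it suffices
   that the expected number of such particles is finite, whether or not they are
   ever activated.  Given a lifetime [m], decomposing the visits to the root
   before time [2 m] at the first one gives

     (sum over x of P_x(root hit before m)) * G_m <= 2 m,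

   where [G_m] is the expected number of visits to the root before time [m] of
   the walk started at the root; here the left-hand side is at most the sum over
   [x] and [n < 2 m] of p_n(x, root), and on a regular graph p_n is doubly
   stochastic.  It remains to use G_m >= 1 in general, and to bound G_m from
   below by a multiple of [sqrt m] on Z and of [log m] on Z^2.  For this,
   p_{2n}(0, 0) is the sum over [x] of p_n(0, x)^2, and since the second moment
   of p_n(0, .) is [n], half of its mass lies in a box of side of order
   [sqrt n], so that p_{2n}(0, 0) is at least of order n^(-d/2). *)
Require Import Defs.
From mathcomp Require Import all_boot all_order all_algebra finmap.
From mathcomp Require Import all_classical all_reals all_analysis.
From mathcomp Require Import measurable_realfun.
From mathcomp Require Import ring lra zify.
(* Makes [root] denote the root of a graph again, not [poly.root]. *)
Import Defs.

Set Implicit Arguments.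
Unset Strict Implicit.
Unset Printing Implicit Defensive.

Import Order.TTheory GRing.Theory Num.Theory.

Local Open Scope classical_set_scope.
Local Open Scope ring_scope.

(** * Averaging on regular graphs *)

Section RegularGraph.
Variables (R : realType) (G : rooted_graph).

Definition regular_graph (k : nat) : Prop :=
  (0 < k)%N /\ forall x : G, finite_set (neighbors x) /\ degree x = k.

Definition nbhd (x : G) : {fset G} := fset_set (neighbors x).

(** The transition operator of the simple random walk. *)
Definition avg (f : G -> R) (x : G) : R :=
  (degree x)%:R^-1 * \sum_(y <- nbhd x) f y.

(* The probability that a walk from [x] is at the root at time [n]. *)
Definition at_root (n : nat) : G -> R :=
  iter n avg (fun x => (x == root)%:R).

(* The probability that a walk from [x] reaches the root for the first time at
   time [n]. *)
Fixpoint first_at_root (n : nat) (x : G) : R :=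
  if n is n'.+1 then if x == root then 0 else avg (first_at_root n') x
  else (x == root)%:R.

Definition hit_before (m : nat) (x : G) : R :=
  \sum_(0 <= j < m) first_at_root j x.

Definition green (m : nat) : R := \sum_(0 <= n < m) at_root n root.

Lemma avg_ge0 f x : (forall y, 0 <= f y) -> 0 <= avg f x.
Proof. by move=> f0; rewrite mulr_ge0 ?invr_ge0// sumr_ge0. Qed.

Lemma at_root_ge0 n x : 0 <= at_root n x.
Proof. by elim: n x => [|n IH] x /=; [rewrite ler0n | exact: avg_ge0]. Qed.

Lemma first_at_root_ge0 n x : 0 <= first_at_root n x.
Proof.
elim: n x => [|n IH] x /=; first by rewrite ler0n.
by case: ifP => // _; exact: avg_ge0.
Qed.

Lemma hit_before_ge0 m x : 0 <= hit_before m x.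
Proof. by rewrite sumr_ge0// => j _; exact: first_at_root_ge0. Qed.

Lemma avg_sum n (F : nat -> G -> R) x :
  avg (fun y => \sum_(0 <= j < n) F j y) x = \sum_(0 <= j < n) avg (F j) x.
Proof. by rewrite /avg exchange_big mulr_sumr. Qed.

Lemma avgZ c f x : avg (fun y => f y * c) x = avg f x * c.
Proof. by rewrite /avg -mulr_suml mulrA. Qed.

Lemma eq_avg f g x : f =1 g -> avg f x = avg g x.
Proof. by move=> fg; rewrite /avg; under eq_bigr do rewrite fg. Qed.

(** First-passage decomposition. At the root only the term [j = 0] survives; elsewhere that term
    vanishes, and averaging over the first step raises [j] by one. *)
Lemma at_root_first_passage n x :
  at_root n x = \sum_(0 <= j < n.+1) first_at_root j x * at_root (n - j) root.
Proof.
have [->|x0] := eqVneq x root.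
  rewrite big_nat_recl//= eqxx mul1r subn0 big1 ?addr0// => j _.
  by rewrite mul0r.
elim: n x x0 => [|n IH] x x0; first by rewrite big_nat1 /= (negPf x0) mul0r.
rewrite big_nat_recl//= (negPf x0) mul0r add0r.
rewrite [LHS](_ : _ = avg (fun y => \sum_(0 <= j < n.+1)
    first_at_root j y * at_root (n - j) root) x); last first.
  (* The induction hypothesis excludes the root, where the identity is immediate. *)
  apply: eq_avg => y; have [->|] := eqVneq y root; last exact: IH.
  rewrite big_nat_recl//= eqxx mul1r subn0 big1 ?addr0// => j _.
  by rewrite mul0r.
by rewrite avg_sum; apply: eq_bigr => j _; rewrite avgZ.
Qed.

(** Sum the decomposition over [n < 2 m]. For every [j < m] the window [j <= n < j + m] fits in this
    range and contributes [first_at_root j x * green m]; the other terms are nonnegative. *)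
Lemma hit_before_green m x :
  hit_before m x * green m <= \sum_(0 <= n < m.*2) at_root n x.
Proof.
(* Extension by zero makes the ranges of [j] and [n] rectangular, so that the sums can be
   exchanged. *)
pose F j n := if (j < n.+1)%N then first_at_root j x * at_root (n - j) root
  else 0.
have F0 j n : 0 <= F j n.
  by rewrite /F; case: ifP; rewrite ?mulr_ge0 ?first_at_root_ge0 ?at_root_ge0.
have -> : \sum_(0 <= n < m.*2) at_root n x =
    \sum_(0 <= j < m.*2) \sum_(0 <= n < m.*2) F j n.
  rewrite exchange_big_nat /= big_nat [RHS]big_nat;
    apply: eq_bigr => n /andP[_ nm].
  by rewrite at_root_first_passage (big_nat_widen _ n.+1 m.*2)// big_mkcond.
have m2 : (m <= m.*2)%N by lia.
rewrite /hit_before mulr_suml [leRHS](big_cat_nat (n := m))//=.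
rewrite -[leLHS]addr0 lerD//; last first.
  by rewrite !sumr_ge0// => j _; rewrite sumr_ge0.
rewrite !big_nat; apply: ler_sum => j /andP[_ jm].
rewrite (big_cat_nat (n := j)) //=; last by lia.
rewrite [X in _ + X](big_cat_nat (n := (m + j)%N)) /=; [|lia|lia].
rewrite -[leLHS]add0r lerD ?sumr_ge0//.
rewrite -[leLHS]addr0 lerD ?sumr_ge0//.
rewrite -[X in index_iota X _]add0n big_addn addnK mulr_sumr;
  apply: ler_sum => n _.
by rewrite /F ltnS leq_addl addnK.
Qed.

(** * Reversibility of the walk on a regular graph *)

Section Regular.
Variable k : nat.
Hypothesis regG : regular_graph k.

Let k_neq0 : (k%:R : R) != 0.
Proof. by case: regG => k0 _; rewrite pnatr_eq0 -lt0n. Qed.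

Lemma in_nbhd x y : (y \in nbhd x) = adj x y.
Proof.
case: regG => _ /(_ x)[fx _]; rewrite in_fset_set//.
by apply/idP/idP; rewrite inE.
Qed.

Lemma nbhd_sym x y : (x \in nbhd y) = (y \in nbhd x).
Proof. by rewrite !in_nbhd adj_sym. Qed.

Lemma avg_cst c x : avg (fun=> c) x = c.
Proof.
case: regG => _ /(_ x)[_ dx]; rewrite /avg dx.
have -> : \sum_(y <- nbhd x) c = c * k%:R.
  by rewrite big_const_seq count_predT iter_addr_0 -dx mulr_natr.
by rewrite mulrC mulfK.
Qed.

Lemma sum_nbhd (X : {fset G}) (f : G -> R) x :
  (forall y, y \in nbhd x -> y \notin X -> f y = 0) ->
  \sum_(y <- nbhd x) f y = \sum_(y <- X) (adj x y)%:R * f y.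
Proof.
move=> fX.
transitivity (\sum_(y <- (nbhd x `|` X)%fset) (adj x y)%:R * f y).
  rewrite -[RHS](@big_fset_incl _ _ _ _ (nbhd x)) ?fsubsetUl//.
    rewrite big_seq [RHS]big_seq; apply: eq_bigr => y.
    by rewrite in_nbhd => ->; rewrite mul1r.
  by move=> y _; rewrite in_nbhd => /negPf ->; rewrite mul0r.
rewrite -[LHS](@big_fset_incl _ _ _ _ X) ?fsubsetUr// => y + yX.
by rewrite inE (negPf yX) orbF => /fX/(_ yX) ->; rewrite mulr0.
Qed.

(** Self-adjointness: adjacency is symmetric and the degree is constant. The hypothesis keeps the
    support of [f] and its neighbours inside [X], so that no term is cut off. *)
Lemma avg_adjoint (X : {fset G}) (g f : G -> R) :
  (forall y, f y != 0 -> y \in X /\ (nbhd y `<=` X)%fset) ->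
  \sum_(x <- X) g x * avg f x = \sum_(y <- X) avg g y * f y.
Proof.
move=> fX; have degE (x : G) : degree x = k by case: regG => _ /(_ x)[].
transitivity (\sum_(x <- X) \sum_(y <- X) k%:R^-1 * (adj x y)%:R * g x * f y).
  apply: eq_bigr => x _; rewrite /avg degE (@sum_nbhd X); last first.
    by move=> y _ yX; apply: contraNeq yX => /fX[].
  by rewrite !mulr_sumr; apply: eq_bigr => y _; ring.
rewrite exchange_big; apply: eq_bigr => y _ /=.
have [->|/fX[_ /fsubsetP yX]] := eqVneq (f y) 0.
  by rewrite mulr0 big1// => x _; rewrite mulr0.
rewrite /avg degE (@sum_nbhd X) => [|x /yX ->//].
by rewrite mulr_sumr mulr_suml; apply: eq_bigr => x _; rewrite adj_sym; ring.
Qed.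

(** The ball of radius [n] about the root; it contains the support of [at_root n], which keeps the
    sums finite. *)
Fixpoint gball (n : nat) : {fset G} :=
  if n is n'.+1 then (gball n' `|` \bigcup_(x <- gball n') nbhd x)%fset
  else [fset root]%fset.

Lemma gball_sub n : (gball n `<=` gball n.+1)%fset.
Proof. exact: fsubsetUl. Qed.

Lemma leq_gball m n : (m <= n)%N -> (gball m `<=` gball n)%fset.
Proof.
move/subnK <-; elim: (n - m)%N => [|i IH]; first exact: fsubset_refl.
exact: fsubset_trans IH (gball_sub _).
Qed.

Lemma nbhd_gball n x : x \in gball n -> (nbhd x `<=` gball n.+1)%fset.
Proof.
move=> xn; apply: fsubset_trans (fsubsetUr _ _).
exact: bigfcup_sup.
Qed.

Lemma at_root_supp n x : at_root n x != 0 -> x \in gball n.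
Proof.
elim: n x => [|n IH] x /=.
  by rewrite pnatr_eq0 eqb0 negbK => /eqP->; rewrite inE.
rewrite mulf_eq0 negb_or => /andP[_].
have [/hasP[y xy /IH yn] _|/hasPn n0] := boolP (has (fun y => at_root n y != 0)
  (nbhd x)).
  by apply: (fsubsetP (nbhd_gball yn)); rewrite nbhd_sym.
by rewrite big_seq big1 ?eqxx// => y /n0; rewrite negbK => /eqP.
Qed.

Lemma at_root_interior m n (X : {fset G}) : (gball n `<=` X)%fset -> (m < n)%N
  ->
  forall y, at_root m y != 0 -> y \in X /\ (nbhd y `<=` X)%fset.
Proof.
move=> nX mn y /at_root_supp ym; split.
  exact/(fsubsetP nX)/(fsubsetP (leq_gball (ltnW mn))).
exact: fsubset_trans (nbhd_gball ym) (fsubset_trans (leq_gball mn) nX).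
Qed.

Lemma sum_root_delta (X : {fset G}) (g : G -> R) : root \in X ->
  \sum_(x <- X) g x * (x == root)%:R = g root.
Proof.
move=> rX; rewrite (big_fsetD1 root)//= eqxx mulr1 big_seq big1 ?addr0// => x.
by rewrite !inE => /andP[/negPf-> _]; rewrite mulr0.
Qed.

(** Write the sum as a pairing with the constant 1, which [avg] fixes, and move the averages onto it
    one by one. *)
Lemma sum_at_root n (X : {fset G}) : (gball n `<=` X)%fset ->
  \sum_(x <- X) at_root n x = 1.
Proof.
elim: n => [|n IH] nX.
  under eq_bigr do rewrite -[at_root 0 _]mul1r.
  by rewrite (@sum_root_delta _ (fun=> 1))// (fsubsetP nX)//= inE.
under eq_bigr do rewrite -[at_root n.+1 _]mul1r.
rewrite (@avg_adjoint _ (fun=> 1)); last exact: at_root_interior nX _.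
under eq_bigr do rewrite avg_cst mul1r.
exact: IH (fsubset_trans (gball_sub n) nX).
Qed.

Lemma sum_at_root_le1 n (X : {fset G}) : \sum_(x <- X) at_root n x <= 1.
Proof.
rewrite -(@sum_at_root n (X `|` gball n)%fset) ?fsubsetUr//.
rewrite [leRHS](big_fsetID _ (fun x => x \in X))/=.
rewrite [X in _ <= X + _](_ : _ = \sum_(x <- X) at_root n x).
  by rewrite lerDl sumr_ge0// => x _; exact: at_root_ge0.
by apply: eq_fbigl => x; rewrite !inE /=; case: (x \in X);
  rewrite ?andbT ?andbF.
Qed.

Lemma sum_hit_before_green m (X : {fset G}) :
  (\sum_(x <- X) hit_before m x) * green m <= (m.*2)%:R.
Proof.
rewrite mulr_suml;
  apply: le_trans (ler_sum _ (fun x _ => hit_before_green m x)) _.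
rewrite exchange_big /= -[leRHS](_ : \sum_(0 <= n < m.*2) (1 : R) = _).
  by apply: ler_sum => n _; exact: sum_at_root_le1.
by rewrite big_const_nat iter_addr_0 subn0.
Qed.

(** By reversibility the averages in one factor move one at a time to the other, until a point mass
    at the root is left. *)
Lemma at_root_double n (X : {fset G}) : (gball n.*2 `<=` X)%fset ->
  at_root n.*2 root = \sum_(x <- X) at_root n x ^+ 2.
Proof.
move=> nX.
have shift i : (i <= n)%N -> \sum_(x <- X) at_root n x ^+ 2 =
    \sum_(x <- X) at_root (n + i) x * at_root (n - i) x.
  elim: i => [_|i IH ni].
    by rewrite addn0 subn0; under eq_bigr do rewrite expr2.
  rewrite IH ?(ltnW ni)// -(subnSK ni) addnS; apply: avg_adjoint.
  by apply: at_root_interior nX _; lia.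
rewrite (shift n)// subnn addnn sum_root_delta//.
by apply: (fsubsetP nX); apply: (fsubsetP (leq_gball (leq0n _))); rewrite inE.
Qed.

End Regular.
End RegularGraph.

Arguments gball {G} n.

(** * Simple random walk on the lattice *)

Section Lattice.
Variables (R : realType) (d : nat).
(** In dimension zero the origin would have no neighbour; [d = 0] is the case of Z. *)
Notation G := (Zlattice d.+1).

Lemma lattice_adjD (x y z : 'rV[int]_d.+1) :
  lattice_adj (x + y) (x + z) = lattice_adj y z.
Proof.
rewrite /lattice_adj; congr (_ == _); apply: eq_bigr => i _.
by rewrite !mxE opprD addrACA subrr add0r.
Qed.

Lemma lattice_adjN (x y : 'rV[int]_d.+1) :
  lattice_adj (- x) (- y) = lattice_adj x y.
Proof.
rewrite /lattice_adj; congr (_ == _); apply: eq_bigr => i _.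
by rewrite !mxE opprK addrC distrC.
Qed.

Lemma lattice_adj0 (z : 'rV[int]_d.+1) :
  lattice_adj 0 z -> forall i, `|z ord0 i| <= 1.
Proof.
rewrite /lattice_adj => /eqP <- i.
by rewrite (bigD1 i)//= mxE sub0r normrN lerDl sumr_ge0.
Qed.

Lemma lattice_neighborsE (x : G) :
  neighbors x = (fun z : G => x + z : G) @` neighbors (root : G).
Proof.
apply/seteqP; split=> [y xy|_ [z z0 <-]]; last first.
  by move: z0; rewrite /neighbors /= -{1}[x]addr0 lattice_adjD.
exists (- x + y); last by rewrite /= addrA subrr add0r.
by move: xy; rewrite /neighbors /= -(lattice_adjD (- x)) addNr.
Qed.

Lemma finite_lattice_neighbors (x : G) : finite_set (neighbors x).
Proof.
rewrite lattice_neighborsE; apply: finite_image.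
(* The coordinates of a neighbour of the origin are -1, 0 or 1, coded by ['I_3] after a shift. *)
apply: (@sub_finite_set _ _ (range (fun u : 'rV['I_3]_d.+1 =>
    \row_i ((u ord0 i : nat)%:Z - 1) : G))); last exact: finite_image.
move=> z /lattice_adj0 z1; exists (\row_i inord (absz (z ord0 i + 1))) => //.
have shift (a : int) : `|a| <= 1 -> (absz (a + 1)%R < 3)%N /\ (absz (a + 1))%:Z
  - 1 = a.
  by split; lia.
apply/rowP => i; have [z3 zE] := shift _ (z1 i).
by rewrite !mxE inordK// zE ord1.
Qed.

Lemma lattice_nbhdE (x : G) :
  nbhd x = [fset ((x + z)%R : G) | z in nbhd (root : G)]%fset.
Proof.
rewrite /nbhd lattice_neighborsE fset_set_image//.
exact: finite_lattice_neighbors.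
Qed.

Lemma lattice_degree (x : G) : degree x = degree (root : G).
Proof. by rewrite /degree -!/(nbhd _) lattice_nbhdE card_imfset//;
  exact: addrI. Qed.

Lemma lattice_degree_gt0 : (0 < degree (root : G))%N.
Proof.
rewrite /degree cardfs_gt0; apply/fset0Pn.
exists (\row_i (i == ord0)%:Z : G); rewrite in_fset_set; last first.
  exact: finite_lattice_neighbors.
rewrite inE /neighbors /= /lattice_adj (bigD1 ord0)//= !mxE eqxx big1 ?addr0//.
by move=> i /negPf i0; rewrite !mxE i0 subrr normr0.
Qed.

Lemma lattice_regular : regular_graph G (degree (root : G)).
Proof.
split=> [|x]; first exact: lattice_degree_gt0.
by split; [exact: finite_lattice_neighbors | exact: lattice_degree].
Qed.

Lemma lattice_avg (f : G -> R) (x : G) :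
  avg f x = (degree (root : G))%:R^-1 * \sum_(z <- nbhd (root : G)) f (x + z).
Proof.
rewrite /avg lattice_degree lattice_nbhdE big_imfset//= => z t _ _.
exact: addrI.
Qed.

Lemma lattice_nbhd0_opp :
  nbhd (root : G) = [fset ((- z)%R : G) | z in nbhd (root : G)]%fset.
Proof.
apply/fsetP => z; apply/idP/imfsetP => [|[t /= + ->]].
  rewrite !(in_nbhd lattice_regular) /= => z0; exists (- z); rewrite ?opprK//=.
  by rewrite (in_nbhd lattice_regular) /= -{1}oppr0 lattice_adjN.
by rewrite !(in_nbhd lattice_regular) /= -{2}oppr0 lattice_adjN.
Qed.

Lemma lattice_avgN (f : G -> R) (x : G) :
  avg f x = (degree (root : G))%:R^-1 * \sum_(z <- nbhd (root : G)) f (x - z).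
Proof.
rewrite lattice_avg [in LHS]lattice_nbhd0_opp big_imfset//= => z t _ _.
exact: oppr_inj.
Qed.

(** * Second moment of the walk and return probabilities *)

Definition normsq (x : G) : R := \sum_i (x ord0 i)%:~R ^+ 2.

Lemma normsq_unit (z : G) : z \in nbhd (root : G) -> normsq z = 1.
Proof.
have sq (a : int) : `|a| <= 1 -> a ^+ 2 = `|a|.
  by move=> a1; have [->|[->|->]] : a = -1 \/ (a = 0 \/ a = 1) by lia.
rewrite (in_nbhd lattice_regular) /= => z0; have z1 := lattice_adj0 z0.
move: z0; rewrite /lattice_adj => /eqP z0.
rewrite -[1](_ : (1 : int)%:~R = _)// -[in RHS]z0 rmorph_sum.
apply: eq_bigr => i _; rewrite -rmorphXn mxE sub0r normrN; congr (_%:~R).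
exact: sq (z1 i).
Qed.

(** Averaging over the steps [z] and [- z] together cancels the cross terms by the parallelogram
    identity, and each step has squared norm 1. *)
Lemma avg_normsq (x : G) : avg normsq x = normsq x + 1.
Proof.
have par (z : G) : normsq (x + z) + normsq (x - z) = normsq x *+ 2 + normsq z
  *+ 2.
  rewrite /normsq -!sumrMnl -!big_split; apply: eq_bigr => i _ /=.
  by rewrite !mxE !(intrD, intrB); ring.
have: avg normsq x *+ 2 = (normsq x + 1) *+ 2.
  rewrite mulr2n {1}lattice_avg lattice_avgN -mulrDr -big_split /=.
  rewrite -[RHS](avg_cst lattice_regular _ x) lattice_avg; congr (_ * _).
  rewrite big_seq [RHS]big_seq; apply: eq_bigr => z z0.
  by rewrite par (normsq_unit z0) mulrnDl.
by move: (avg _ x) (normsq x + 1) => a b; rewrite !mulr2n => ab; lra.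
Qed.

(** Moving one average from [at_root] to [normsq] adds the total mass, which is 1. *)
Lemma sum_normsq_at_root n (X : {fset G}) : (gball n `<=` X)%fset ->
  \sum_(x <- X) normsq x * at_root R n x = n%:R.
Proof.
elim: n => [|n IH] nX.
  rewrite (@sum_root_delta R G X normsq); last by rewrite (fsubsetP nX)//= inE.
  by rewrite /normsq big1// => i _; rewrite mxE expr0n.
rewrite (avg_adjoint lattice_regular); last first.
  exact: (at_root_interior lattice_regular) nX _.
under eq_bigr do rewrite avg_normsq mulrDl mul1r.
have nX' := fsubset_trans (gball_sub _ n) nX.
by rewrite big_split /= IH// (sum_at_root R lattice_regular)// natr1.
Qed.

Definition in_box (r : nat) (x : G) := [forall i, (`|x ord0 i| <= r%:Z)].

Lemma sum_in_box r (X : {fset G}) :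
  \sum_(x <- X) ((in_box r x)%:R : R) <= ((r.*2.+1) ^ d.+1)%:R.
Proof.
rewrite -natr_sum -big_mkcond /= sum1_count ler_nat -size_filter.
pose f (x : G) : 'rV['I_r.*2.+1]_d.+1 := \row_i inord (absz (x ord0 i + r%:Z)).
have shift (a : int) : `|a| <= r%:Z ->
    (absz (a + r%:Z)%R < r.*2.+1)%N /\ (absz (a + r%:Z))%:Z - r%:Z = a.
  by split; lia.
have fi : {in [seq x <- X | in_box r x] &, injective f}.
  move=> x y; rewrite !mem_filter => /andP[/forallP xr _] /andP[/forallP yr _].
  move=> /rowP fxy; apply/rowP => i; have := fxy i; rewrite !mxE.
  have [xi xE] := shift _ (xr i); have [yi yE] := shift _ (yr i).
  move=> /(congr1 val); rewrite /= !inordK// => e.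
  by apply: etrans (esym xE) _; rewrite e yE.
have u : uniq (map f [seq x <- X | in_box r x]).
  by rewrite map_inj_in_uniq// filter_uniq// fset_uniq.
rewrite -(size_map f) -(card_uniqP u) (leq_trans (max_card _))//.
by rewrite card_mx card_ord mul1n.
Qed.

Lemma normsq_ge0 x : 0 <= normsq x.
Proof. by rewrite sumr_ge0// => i _; rewrite sqr_ge0. Qed.

Lemma normsq_notin_box r x : ~~ in_box r x -> (r ^ 2)%:R <= normsq x.
Proof.
move=> /forallPn[i xi]; rewrite /normsq (bigD1 i)//=.
rewrite -[leLHS]addr0 lerD ?sumr_ge0// => [|j _]; last by rewrite sqr_ge0.
rewrite natrX -(real_normK (num_real (x ord0 i)%:~R)) lerXn2r ?nnegrE//.
by rewrite -intr_norm -[_%:R]/((r%:Z)%:~R) ler_int ltW// ltNge.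
Qed.

(* Mass [1/2] of the law at time [n] lies in the box, by Chebyshev; spreading it
   evenly there minimises the sum of squares.  The quadratic bound
   [a ^+ 2 >= 2 * t * a - t ^+ 2] replaces the Cauchy-Schwarz inequality. *)
Lemma at_root_double_ge n r : (0 < n)%N -> (n.*2 <= r ^ 2)%N ->
  (4 * ((r.*2.+1) ^ d.+1)%:R)^-1 <= at_root R n.*2 (root : G).
Proof.
move=> n0 nr; set X := gball n.*2 : {fset G}.
have nX : (gball n `<=` X)%fset by apply: leq_gball; lia.
rewrite (at_root_double R lattice_regular (X := X)) ?fsubset_refl//.
set N : R := (_ ^ _)%:R; have N0 : 0 < N by rewrite ltr0n expn_gt0.
(* This [t] maximises [t - t ^+ 2 * N], with maximum [(4 * N)^-1]. *)
pose t := (2 * N)^-1; have t0 : 0 < t by rewrite invr_gt0 mulr_gt0.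
have n0' : 0 < n%:R :> R by rewrite ltr0n.
(* Outside the box [normsq x >= r ^ 2 >= 2 * n], so the second-moment term at least cancels the
   first one. *)
have le x : 2 * t * at_root R n x - t / n%:R * (normsq x * at_root R n x)
    - t ^+ 2 * (in_box r x)%:R <= at_root R n x ^+ 2.
  have a0 := at_root_ge0 R n x; set a := at_root R n x in a0 *.
  have := normsq_ge0 x; case: (boolP (in_box r x)) => [_|/normsq_notin_box] q.
    have q' : 0 <= t / n%:R * (normsq x * a).
      by rewrite mulr_ge0 ?mulr_ge0 ?divr_ge0 ?(ltW t0).
    move: q'; set Q := t / _ * _ => Q0; rewrite mulr1.
    by have := sqr_ge0 (a - t); rewrite sqrrB !expr2 => sq; lra.
  move=> _; rewrite mulr0 subr0 (le_trans _ (sqr_ge0 a))//.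
  have -> : 2 * t * a - t / n%:R * (normsq x * a) =
      t / n%:R * a * (n%:R *+ 2 - normsq x).
    by field; rewrite gt_eqF.
  rewrite mulr_ge0_le0 ?mulr_ge0 ?divr_ge0 ?(ltW t0)// subr_le0 (le_trans _
    q)//.
  by rewrite -mulr_natr -natrM ler_nat muln2.
apply: le_trans (ler_sum _ (fun x _ => le x)).
rewrite !sumrB -!mulr_sumr (sum_at_root R lattice_regular)//.
rewrite sum_normsq_at_root// divfK ?gt_eqF//.
have := sum_in_box r X; rewrite -/N; set S := \sum_(_ <- _) _ => SN.
rewrite (@le_trans _ _ (t - t ^+ 2 * N))//; last first.
  by have := ler_wpM2l (sqr_ge0 t) SN; lra.
by rewrite /t le_eqVlt; apply/orP; left; apply/eqP; field; rewrite gt_eqF.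
Qed.

End Lattice.

(** * Lower bounds for the Green function *)

Section Green.
Variables (R : realType) (G : rooted_graph).

Lemma green_ge1 m : (0 < m)%N -> 1 <= green R G m.
Proof.
case: m => // m _; rewrite /green big_nat_recl//= eqxx lerDl.
by rewrite sumr_ge0// => i _; exact: (at_root_ge0 R i.+1).
Qed.

(** Odd times are dropped; [uphalf m] even times lie below [m]. *)
Lemma green_ge_even m :
  \sum_(0 <= n < uphalf m) at_root R n.*2 (root : G) <= green R G m.
Proof.
elim: m => [|m IH]; first by rewrite /green !big_geq.
have -> : green R G m.+1 = green R G m + at_root R m (root : G).
  by rewrite /green big_nat_recr.
have [m_odd|m_even] := boolP (odd m).
  have -> : uphalf m.+1 = uphalf m by move: m_odd; lia.
  by rewrite (le_trans IH)// lerDl at_root_ge0.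
have U : uphalf m = m./2 by move: m_even; lia.
rewrite [uphalf m.+1]/= big_nat_recr//= -U.
by rewrite {2}U even_halfK// lerD.
Qed.

Lemma sum_hit_before_le k (g C : R) m (X : {fset G}) : regular_graph G k ->
  0 <= C * g -> (m.*2)%:R <= C * g * green R G m ->
  \sum_(x <- X) hit_before R m x <= C * g.
Proof.
move=> regG Cg0 mC; have [->|m0] := posnP m.
  by rewrite big1// => x _; rewrite /hit_before big_geq.
have := le_trans (sum_hit_before_green R regG m X) mC.
by rewrite ler_pM2r// (lt_le_trans _ (green_ge1 m0)).
Qed.

End Green.

(** Take the least [r] with [2 n <= r ^ 2], so that [(r - 1) ^ 2 < 2 n]. The constant 25 is attained
    at [n = 1], where [r = 2]. *)
Lemma exists_box_size n : (0 < n)%N ->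
  exists2 r, (n.*2 <= r ^ 2)%N & ((r.*2.+1) ^ 2 <= 25 * n)%N.
Proof.
move=> n0; have ex : exists r, (n.*2 <= r ^ 2)%N.
  by exists n.*2; rewrite -{1}[n.*2]muln1 leq_mul2l; lia.
have := ex_minnP ex; case=> -[|s] ns mins; first by move: ns; lia.
exists s.+1 => //; have /negP : ~ (n.*2 <= s ^ 2)%N by move=> /mins;
  rewrite ltnn.
by move=> {ns mins}; nia.
Qed.

(** * Growth of the Green function in dimensions one and two *)

Section GreenZ.
Variable R : realType.

(** At least [m / 2] even times contribute at least [1 / (20 * sqrt m)] each. *)
Lemma green_Z1 m : Num.sqrt m%:R <= 40 * green R (Zlattice 1) m.
Proof.
have [->|m0] := posnP m; first by rewrite sqrtr0 mulr_ge0// /green big_geq.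
set s : R := Num.sqrt m%:R; have s0 : 0 < s by rewrite sqrtr_gt0 ltr0n.
have s1 : 1 <= s by rewrite -sqrtr1 ler_wsqrtr// ler1n.
have sE : s ^+ 2 = m%:R by rewrite sqr_sqrtr.
(* The box has side at most [5 * s], which gives [20 = 4 * 5]; time 0 uses [s >= 1]. *)
have low n : (n <= m)%N -> (20 * s)^-1 <= at_root R n.*2 (root : Zlattice 1).
  case: n => [_|n nm].
    by rewrite /= eqxx invf_le1 ?mulr_gt0//; lra.
  have [r nr rn] := @exists_box_size n.+1 isT.
  apply: le_trans (at_root_double_ge R 0 (ltn0Sn n) nr).
  rewrite lef_pV2 ?posrE ?mulr_gt0 ?ltr0n ?expn_gt0// expn1.
  suff : r.*2.+1%:R <= 5 * s by lra.
  rewrite -(@ler_pXn2r _ 2) ?nnegrE ?mulr_ge0 ?(ltW s0)// exprMn sE -natrX.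
  by rewrite -natrX -natrM ler_nat (leq_trans rn)// leq_mul2l nm orbT.
have := green_ge_even R (Zlattice 1) m.
have : \sum_(0 <= n < uphalf m) (20 * s)^-1 <=
    \sum_(0 <= n < uphalf m) at_root R n.*2 (root : Zlattice 1).
  rewrite !big_nat; apply: ler_sum => n /andP[_ nm]; apply: low; lia.
rewrite big_const_nat iter_addr_0 subn0 => h1 h2.
have {h1 h2} h := le_trans h1 h2.
apply: le_trans (_ : 40 * ((20 * s)^-1 *+ uphalf m) <= _); last by lra.
have : (m%:R : R) <= (uphalf m)%:R *+ 2.
  by rewrite -mulrnA ler_nat; lia.
rewrite -sE -[(20 * s)^-1 *+ _]mulr_natr => u.
have -> : 40 * ((20 * s)^-1 * (uphalf m)%:R) = ((uphalf m)%:R *+ 2) / s.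
  by field; rewrite gt_eqF.
by rewrite ler_pdivlMr// -expr2.
Qed.

(** Induction from [ln (1 + x) <= x] at [x = 1 / (n + 1)]. *)
Lemma ln_le_harmonic n : ln (n.+1)%:R <= \sum_(0 <= k < n) (k.+1)%:R^-1 :> R.
Proof.
elim: n => [|n IH]; first by rewrite ln1 big_geq.
rewrite big_nat_recr//=.
have -> : n.+2%:R = n.+1%:R * (1 + n.+1%:R^-1) :> R.
  by rewrite mulrDr mulr1 mulfV ?pnatr_eq0// natr1.
rewrite lnM ?posrE ?addr_gt0 ?invr_gt0// lerD// le_ln1Dx//.
by rewrite (lt_trans (ltrN10 R))// invr_gt0.
Qed.

(** The even times dominate a harmonic sum with factor [1 / 100], where [100 = 4 * 25] comes from
    the box size. At [m = 0] the bound fails: [green] is 0 and the logarithm is [ln 2]. *)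
Lemma green_Z2 m : (0 < m)%N ->
  ln (maxn m 2)%:R <= 200 * green R (Zlattice 2) m.
Proof.
move=> m0.
have low n : 100^-1 * n.+1%:R^-1 <= at_root R n.*2 (root : Zlattice 2).
  rewrite -invfM; case: n => [|n].
    by rewrite /= eqxx mulr1 invf_le1//; lra.
  have [r nr rn] := @exists_box_size n.+1 isT.
  apply: le_trans (at_root_double_ge R 1 (ltn0Sn n) nr).
  rewrite lef_pV2 ?posrE ?mulr_gt0 ?ltr0n ?expn_gt0//.
  rewrite -!natrM ler_nat; lia.
have := green_ge_even R (Zlattice 2) m.
have : \sum_(0 <= n < uphalf m) (100^-1 * n.+1%:R^-1) <=
    \sum_(0 <= n < uphalf m) at_root R n.*2 (root : Zlattice 2).
  by apply: ler_sum => n _; exact: low.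
rewrite -mulr_sumr; have := ln_le_harmonic (uphalf m).
(* The factor 2 comes from [maxn m 2 <= (uphalf m + 1) ^ 2]. *)
have : ln (maxn m 2)%:R <= 2 * ln ((uphalf m).+1)%:R :> R.
  rewrite mulr_natl -lnXn ?ltr0n// -natrX ler_ln ?posrE ?ltr0n//; last by nia.
  rewrite ler_nat; nia.
lra.
Qed.

End GreenZ.

(** * First passage of a random walk at the root *)

Section CountableCover.
Context d (Om : measurableType d) (R : realType).
Local Open Scope ereal_scope.

(** Re-indexes a countable family by codes in [nat], where numbers that code nothing get the empty
    set. This carries results on sequences of events over to families indexed by vertices. *)
Lemma nneseries_pickle_inv (mu : {measure set Om -> \bar R}) (T : countType)
    (F : T -> set Om) :
  \sum_(n <oo) mu (oapp F set0 (@pickle_inv T n)) =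
  \esum_(z in [set: T]) mu (F z).
Proof.
rewrite nneseries_esumT//.
transitivity (\esum_(n in @choice.pickle T @` [set: T])
    mu (oapp F set0 (@pickle_inv T n))).
  rewrite [RHS]esum_mkcond; apply: eq_esum => n _; case: ifPn => // /negP nT.
  case E : (@pickle_inv T n) => [z|]; last by rewrite measure0.
  by case: nT; rewrite inE; exists z => //; have := @pickle_invK T n; rewrite E.
rewrite esum_image; last by move=> x y _ _; exact: (pcan_inj (@pickleK_inv T)).
by apply: eq_esum => z _; rewrite pickleK_inv.
Qed.

Lemma le_measure_countable_cover (mu : {measure set Om -> \bar R}) (T :
  countType)
    (E : set Om) (F : T -> set Om) :
  measurable E -> (forall z, measurable (F z)) -> E `<=` \bigcup_z F z ->
  mu E <= \esum_(z in [set: T]) mu (F z).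
Proof.
move=> mE mF EF; rewrite -nneseries_pickle_inv.
apply: measure_sigma_subadditive => // [n|w /EF[z _ Fzw]].
  by case: pickle_inv => //=.
by exists (choice.pickle z) => //; rewrite pickleK_inv.
Qed.

(** [N] is the limsup along the codes. Outside it, all [z] with [F z w] have codes below some [n],
    and coding is injective. *)
Lemma borel_cantelli_countable (mu : {measure set Om -> \bar R}) (T : countType)
    (F : T -> set Om) : (forall z, measurable (F z)) ->
  \esum_(z in [set: T]) mu (F z) < +oo ->
  exists N, [/\ measurable N, mu N = 0 &
    [set w | infinite_set [set z | F z w]] `<=` N].
Proof.
move=> mF sF; pose F' n := oapp F set0 (@pickle_inv T n).
have mF' n : measurable (F' n) by rewrite /F'; case: pickle_inv => //=.
exists (lim_sup_set F'); split.
- by apply: bigcapT_measurable => n; apply: bigcup_measurable => j _.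
- by apply: lim_sup_set_cvg0 => //; rewrite nneseries_pickle_inv.
move=> w infw n _; apply: contrapT => nF; apply: infw.
have sub : [set z | F z w] `<=` @choice.pickle T @^-1` `I_n.
  move=> z Fz /=; rewrite ltnNge; apply/negP => nz; apply: nF.
  by exists (choice.pickle z) => //; rewrite /F' pickleK_inv.
apply: sub_finite_set sub _; apply: finite_preimage (finite_II n).
by move=> x y _ _; exact: (pcan_inj (@pickleK_inv T)).
Qed.

Lemma esum_fset_supp (T : choiceType) (X : {fset T}) (a : T -> \bar R) :
  (forall z, 0 <= a z) -> (forall z, z \notin X -> a z = 0) ->
  \esum_(z in [set: T]) a z = \sum_(z <- X) a z.
Proof.
move=> a0 aX; rewrite -[X in enum_fset X]set_fsetK -fsbig_finite//.
rewrite -esum_fset// esum_mkcond [in RHS]esum_mkcond; apply: eq_esum => z _.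
by rewrite in_setT; case: ifPn => // /negP zX; rewrite aX//; apply/negP => zX';
  apply: zX; rewrite inE.
Qed.

Lemma measurable_forall_nat (Q : nat -> set Om) :
  (forall i, measurable (Q i)) -> measurable [set w | forall i, Q i w].
Proof.
move=> mQ; rewrite [X in measurable X](_ : _ = \bigcap_i Q i).
  exact: bigcapT_measurable.
by apply/seteqP; split=> [w h i _|w h i]; exact: h.
Qed.

Lemma measurable_exists_count (T : countType) (Q : T -> set Om) :
  (forall i, measurable (Q i)) -> measurable [set w | exists i, Q i w].
Proof.
move=> mQ; rewrite [X in measurable X](_ : _ = \bigcup_i Q i).
  by apply: countable_bigcupT_measurable => //; exact: countableP.
by apply/seteqP; split=> [w [i h]|w [i _ h]]; exists i.
Qed.

Lemma measurable_imply (b : Prop) (Q : set Om) :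
  measurable Q -> measurable [set w | b -> Q w].
Proof.
have [hb|hb] := pselect b => mQ.
  rewrite [X in measurable X](_ : _ = Q)//.
  by apply/seteqP; split=> [w|w Qw _]; [exact|].
rewrite [X in measurable X](_ : _ = setT)//.
by apply/seteqP; split=> // w _ /hb.
Qed.

Lemma measurable_conj (b : Prop) (Q : set Om) :
  measurable Q -> measurable [set w | b /\ Q w].
Proof.
have [hb|hb] := pselect b => mQ.
  rewrite [X in measurable X](_ : _ = Q)//.
  by apply/seteqP; split=> [w []|w Qw].
rewrite [X in measurable X](_ : _ = set0)//.
by apply/seteqP; split=> // w [].
Qed.

End CountableCover.

(** * Hitting probabilities from the Markov property *)

Section FirstPassage.
Context (R : realType) (G : rooted_graph) (k : nat) (regG : regular_graph G k).
Context d (Om : measurableType d) (P : probability Om R).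
Context (x : G) (S : nat -> Om -> G) (srwS : simple_random_walk P x S).
Local Open Scope ereal_scope.

Definition cylinder (n : nat) (y : nat -> G) : set Om :=
  [set w | forall i, (i <= n)%N -> S i w = y i].

Definition reaches_root_at (n m : nat) : set Om :=
  [set w | (forall i, (n <= i < m)%N -> S i w <> root) /\ S m w = root].

Definition visits_root_before (m : nat) : set Om :=
  [set w | exists i, (i < m)%N /\ S i w = root].

Lemma measurable_walk_eq n y : measurable [set w | S n w = y].
Proof. exact: (srw_measurable srwS n [set y]). Qed.

Lemma measurable_cylinder n y : measurable (cylinder n y).
Proof.
apply: measurable_forall_nat => i; apply: (@measurable_imply _ _ _ [set w | _]).
exact: measurable_walk_eq.
Qed.

Lemma measurable_reaches_root_at n m : measurable (reaches_root_at n m).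
Proof.
apply: measurableI; last exact: measurable_walk_eq.
apply: measurable_forall_nat => i; apply: (@measurable_imply _ _ _ [set w | _]).
by apply: (@measurableC _ _ [set w | S i w = root]); exact: measurable_walk_eq.
Qed.

Lemma measurable_visits_root_before m : measurable (visits_root_before m).
Proof.
apply: measurable_exists_count => i;
  apply: (@measurable_conj _ _ _ [set w | _]).
exact: measurable_walk_eq.
Qed.

(** Induction on [j]: away from the root, cover the event by the cylinders that also prescribe the
    position at time [n + 1], and apply the Markov property to each. *)
Lemma cylinder_reaches_root_le j n y :
  P (cylinder n y `&` reaches_root_at n (n + j)) <=
    P (cylinder n y) * (first_at_root R j (y n))%:E.
Proof.
have mE j' n' y' : measurable (cylinder n' y' `&` reaches_root_at n' (n' + j')).
  by apply: measurableI;
    [exact: measurable_cylinder|exact: measurable_reaches_root_at].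
elim: j n y => [|j IH] n y.
  have [yn|yn] := eqVneq (y n) root.
    rewrite /= yn eqxx mule1; apply: le_measure; rewrite ?inE//.
    exact: measurable_cylinder.
  rewrite [X in P X](_ : _ = set0) ?measure0 ?mule_ge0 ?lee_fin
    ?first_at_root_ge0//.
  apply/seteqP; split=> // w [/(_ n (leqnn n)) Sn [_]].
  by rewrite addn0 Sn => /eqP; rewrite (negPf yn).
have [yn|yn] := eqVneq (y n) root.
  rewrite [X in P X](_ : _ = set0) ?measure0 ?mule_ge0 ?lee_fin
    ?first_at_root_ge0//.
  apply/seteqP; split=> // w [/(_ n (leqnn n)) Sn [/(_ n)]].
  by rewrite Sn yn leqnn addnS ltnS leq_addr => /(_ isT).
pose next z i := if i == n.+1 then z else y i.
have next_n z : next z n = y n by rewrite /next ltn_eqF.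
have next_Sn z : next z n.+1 = z by rewrite /next eqxx.
have cylE z : cylinder n (next z) = cylinder n y.
  by apply/seteqP; split=> w h i ni; have := h i ni; rewrite /next ltn_eqF.
apply: le_trans (le_measure_countable_cover (T := G)
  (F := fun z => cylinder n.+1 (next z) `&` reaches_root_at n.+1 (n.+1 + j))
  P (mE _ _ _) (fun z => mE _ _ _) _) _.
  move=> w [cw [nw Sw]]; exists (S n.+1 w) => //; split.
    move=> i; rewrite leq_eqVlt => /predU1P[->|/[!ltnS] ni];
      first by rewrite next_Sn.
    by rewrite /next ltn_eqF// cw.
  split; last by rewrite addSnnS.
  by move=> i /andP[ni inj]; apply: nw; rewrite (ltnW ni) -addSnnS.
apply: le_trans (le_esum (fun z _ => IH n.+1 (next z))) _.
under eq_esum => z _ do rewrite (srw_markov srwS) -/(cylinder _ _) cylE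
  next_n next_Sn -muleA -EFinM.
(* Only the neighbours of [y n] carry a nonzero transition probability. *)
rewrite (@esum_fset_supp _ _ (nbhd (y n))); last 2 first.
- move=> z; rewrite mule_ge0 ?lee_fin// mulr_ge0 ?first_at_root_ge0//.
  by rewrite /srw_step; case: ifP.
- by move=> z; rewrite (in_nbhd regG) /srw_step => /negPf ->;
  rewrite mul0r mule0.
rewrite -ge0_sume_distrr; last first.
  move=> z _; rewrite lee_fin mulr_ge0 ?first_at_root_ge0//.
  by rewrite /srw_step; case: ifP.
rewrite lee_wpmul2l// sumEFin lee_fin /= (negPf yn) /avg mulr_sumr.
rewrite big_seq [leRHS]big_seq; apply: ler_sum => z.
by rewrite (in_nbhd regG) /srw_step => ->.
Qed.

(** Raising [m] by one adds only the event that the first visit happens at time [m]. *)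
Lemma visits_root_before_le m :
  P (visits_root_before m) <= (hit_before R m x)%:E.
Proof.
elim: m => [|m IH].
  rewrite [X in P X](_ : _ = set0) ?measure0 ?lee_fin ?hit_before_ge0//.
  by apply/seteqP; split=> // w [i []].
have -> : hit_before R m.+1 x = (hit_before R m x + first_at_root R m x)%R.
  by rewrite /hit_before big_nat_recr.
have mV := measurable_visits_root_before;
  have mW := measurable_reaches_root_at 0 m.
apply: (@le_trans _ _ (P (visits_root_before m `|` reaches_root_at 0 m))).
  apply: le_measure; rewrite ?inE//; first exact: measurableU.
  move=> w [i []]; rewrite ltnS leq_eqVlt => /predU1P[->|im] Si; last by left;
    exists i.
  have [Vw|nVw] := pselect (visits_root_before m w); [by left|right;
    split=> // j].
  by move=> /andP[_ jm] Sj; apply: nVw; exists j.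
apply: (le_trans (measureU2 _ _ _)) => //; rewrite EFinD leeD//.
have mC := measurable_cylinder 0 (fun=> x).
have mX := measurable_walk_eq 0 x.
(* The walk starts at [x] only almost surely; the exceptional null set is added to the cover. *)
have S0 : P (~` [set w | S 0 w = x]) = 0.
  by rewrite probability_setC// (srw_start srwS) subee.
apply: (@le_trans _ _ (P (cylinder 0 (fun=> x) `&` reaches_root_at 0 m) + 0)).
  rewrite -S0 (le_trans _ (measureU2 _ _ _))//; last 2 first.
    exact: measurableI.
    exact: measurableC.
  apply: le_measure; rewrite ?inE//.
    by apply: measurableU; [exact: measurableI|exact: measurableC].
  move=> w Ww; have [Sw|nSw] := pselect (S 0 w = x); last by right.
  by left; split=> // i; rewrite leqn0 => /eqP ->.
rewrite adde0 (le_trans (cylinder_reaches_root_le m 0 (fun=> x)))//.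
rewrite -[leRHS]mul1e lee_wpmul2r ?lee_fin ?first_at_root_ge0//.
exact: probability_le1.
Qed.

End FirstPassage.

(** * Measurability *)

Section Measurability.
Context d (Om : measurableType d) (R : realType).
Local Open Scope ereal_scope.

(** The infimum is below [r] exactly when some admissible term is, which is a countable union of
    events. *)
Lemma measurable_ereal_inf_count (T : countType) (Q : T -> set Om)
    (h : T -> Om -> \bar R) :
  (forall i, measurable (Q i)) -> (forall i, measurable_fun setT (h i)) ->
  measurable_fun setT (fun w => ereal_inf [set h i w | i in [set i | Q i w]]).
Proof.
move=> mQ mh; apply: (measurability _ (ErealGenInftyO.measurableE R)).
move=> _ /= -[_ [r ->] <-]; rewrite setTI preimage_itvNyo.
rewrite [X in measurable X](_ : _ =
    \bigcup_i (Q i `&` (setT `&` [set w | h i w < r%:E]))).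
  apply: countable_bigcupT_measurable => [|i]; first exact: countableP.
  by apply: measurableI => //; exact: emeasurable_fun_infty_o.
apply/seteqP; split=> w /=.
  by move=> /ereal_inf_ltP[_ [i Qi <-] hi]; exists i.
by move=> [i _ [Qi [_ hi]]]; apply/ereal_inf_ltP; exists (h i w) => //;
  exists i.
Qed.

Lemma infinite_set_natP (A : set nat) :
  infinite_set A <-> forall n, exists k, (n <= k)%N /\ A k.
Proof.
split=> [Ainf n|Aunb].
  apply: contrapT => nA; apply: Ainf; apply: sub_finite_set (finite_II n).
  by move=> k Ak /=; rewrite ltnNge; apply/negP => nk; apply: nA; exists k.
move=> /finite_fsetP[X AX]; have [k []] := Aunb (\max_(i <- X) i).+1.
by rewrite AX /= ltnNge => + kX; rewrite (leq_bigmax_seq (F := id)).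
Qed.

End Measurability.

Section FrogMeasurability.
Context (R : realType) (G : rooted_graph).
Context d (Om : measurableType d) (P : probability Om R).
Variables (L : G -> {RV P >-> nat}) (S : G -> nat -> Om -> G).
Hypothesis mS : forall x n (B : set G), measurable (S x n @^-1` B).
Local Open Scope ereal_scope.

(** Time is counted from the start of the walk of [x], so the event involves only its own lifetime
    and walk, not its activation. *)
Definition root_visitor (x : G) : set Om :=
  [set w | exists n, (n < L x w)%N /\ S x n w = root].

Lemma measurable_lifetime x (B : set nat) : measurable (L x @^-1` B).
Proof. by rewrite -[X in measurable X]setTI;
  exact: (measurable_funPT (L x)). Qed.

Lemma measurable_alive_at x n y :
  measurable [set w | (n < L x w)%N /\ S x n w = y].
Proof.
apply: measurableI; first exact: (measurable_lifetime x [set m | (n < m)%N]).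
exact: (mS x n [set y]).
Qed.

Lemma measurable_hitting_time x y :
  measurable_fun setT (fun w => hitting_time L S w x y).
Proof.
apply: (@measurable_ereal_inf_count _ _ _ nat
  (fun n => [set w | (n < L x w)%N /\ S x n w = y]) (fun n _ => n%:R%:E)) => n.
  exact: measurable_alive_at.
exact: measurable_cst.
Qed.

Lemma measurable_passage_time x p :
  measurable_fun setT (fun w => passage_time L S w x p).
Proof.
elim: p x => [|y p IH] x /=; first exact: measurable_cst.
by apply: emeasurable_funD => //; exact: measurable_hitting_time.
Qed.

Lemma measurable_activation_time x :
  measurable_fun setT (fun w => activation_time L S w x).
Proof.
apply: (@measurable_ereal_inf_count _ _ _ (seq G)
  (fun p => [set w | last root p = x]) (fun p w => passage_time L S w root p)).
  move=> p; have [px|px] := pselect (last root p = x).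
    by rewrite [X in measurable X](_ : _ = setT)//; apply/seteqP; split.
  by rewrite [X in measurable X](_ : _ = set0)//; apply/seteqP; split.
by move=> p; exact: measurable_passage_time.
Qed.

Lemma measurable_active_at k y : measurable [set w | active_at L S w k y].
Proof.
apply: measurable_exists_count => x; apply: measurable_exists_count => n.
rewrite [X in measurable X](_ : _ = [set w | (n < L x w)%N /\ S x n w = y] `&`
    (setT `&` (fun w => activation_time L S w x + n%:R%:E) @^-1` [set
      k%:R%:E])).
  apply: measurableI; first exact: measurable_alive_at.
  have : measurable_fun setT (fun w => activation_time L S w x + n%:R%:E).
    by apply: emeasurable_funD => //; exact: measurable_activation_time.
  by apply.
by apply/seteqP; split=> w /= => [[]|[[? ?] [_ ?]]].
Qed.

(** A set of times is infinite when it is unbounded, which needs only countable unions and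
    intersections. *)
Lemma measurable_root_hit_infinitely_often :
  measurable (root_hit_infinitely_often L S).
Proof.
rewrite [X in measurable X](_ : _ = [set w | forall n,
    [set w | exists k, [set w | (n <= k)%N /\ active_at L S w k root] w] w]).
  apply: measurable_forall_nat => n; apply: measurable_exists_count => k.
  by apply: (@measurable_conj _ _ _ [set w | _]); exact: measurable_active_at.
by apply/seteqP; split=> w /infinite_set_natP.
Qed.

Lemma measurable_root_visitor x : measurable (root_visitor x).
Proof.
by apply: measurable_exists_count => n; exact: measurable_alive_at.
Qed.

(* Each particle is active at finitely many times only. *)
Lemma root_hit_infinitely_often_sub :
  root_hit_infinitely_often L S `<=`
  [set w | infinite_set [set x | root_visitor x w]].
Proof.
move=> w hitw /= finw; apply: hitw; pose T x := activation_time L S w x.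
apply: (@sub_finite_set _ _ (\bigcup_(x in [set x | root_visitor x w])
    \bigcup_(n in `I_(L x w)) [set k : nat | T x + n%:R%:E = k%:R%:E])).
  by move=> k [x [n [nL Tx Sx]]]; exists x; [exists n|exists n].
apply: bigcup_finite => // x _; apply: bigcup_finite => [|n _].
  exact: finite_II.
rewrite [X in finite_set X](_ : _ =
    (fun k : nat => k%:R%:E : \bar R) @^-1` [set T x + n%:R%:E]); last first.
  by apply/seteqP; split=> k /= ->.
apply: finite_preimage (finite_set1 _) => i j _ _ [] /eqP.
by rewrite eqr_nat => /eqP.
Qed.

End FrogMeasurability.

(** * Transience *)

Section Expectation.
Context d (Om : measurableType d) (R : realType) (P : probability Om R).
Variable (X : {RV P >-> nat}).
Local Open Scope ereal_scope.

Lemma measurable_comp_nat d' (T : measurableType d') (f : nat -> T) :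
  measurable_fun setT (f \o X).
Proof.
by move=> _ Y mY; rewrite comp_preimage; exact: (measurable_funPT X).
Qed.

(** Split the space into the level sets of [X]. *)
Lemma expectation_nat (g : nat -> R) : (forall m, (0 <= g m)%R) ->
  'E_P[g \o X] = \esum_(m in [set: nat]) (P (X @^-1` [set m]) * (g m)%:E).
Proof.
move=> g0; have mX (B : set nat) : measurable (X @^-1` B).
  by rewrite -[Y in measurable Y]setTI; exact: (measurable_funPT X).
rewrite unlock -nneseries_esumT => [|m]; last by rewrite mule_ge0// lee_fin.
have XT : \bigcup_m X @^-1` [set m] = setT by apply/seteqP; split=> // w _;
  exists (X w).
rewrite -XT ge0_integral_bigcup//; last 3 first.
- by rewrite XT; exact: (measurable_comp_nat (fun m => (g m)%:E)).
- by move=> w _; rewrite lee_fin; exact: g0.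
- by apply/trivIsetP => i j _ _ ij; apply/seteqP; split=> // w [/= Xi Xj];
  move: ij; rewrite -Xi -Xj eqxx.
apply: eq_eseriesr => m _; under eq_integral => w do rewrite inE /= => ->.
by rewrite integral_cst// muleC.
Qed.

End Expectation.

Section Transience.
Context (R : realType) (G : rooted_graph).
Context d0 (Om0 : measurableType d0) (P0 : probability Om0 R)
  (Xi : {RV P0 >-> nat}).
Context d (Om : measurableType d) (P : probability Om R).
Variables (L : G -> {RV P >-> nat}) (S : G -> nat -> Om -> G).
Hypothesis fm : frog_model Xi L S.
Variable k : nat.
Hypothesis regG : regular_graph G k.
Local Open Scope ereal_scope.

Let mS x n (B : set G) : measurable (S x n @^-1` B).
Proof. exact: (srw_measurable (walk_srw fm x)). Qed.

Lemma probability_lifetime_visit x m :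
  P ((L x @^-1` [set m]) `&` visits_root_before (S x) m) =
  P0 (Xi @^-1` [set m]) * P (visits_root_before (S x) m).
Proof.
rewrite (lifetime_walk_indep fm); last 2 first.
- apply: sub_gen_smallest; exists x => //; exists [set m] => //.
  by rewrite setTI.
(* The visit event belongs to the sigma-algebra of the walks, as a countable union padded with
   [set0] from [m] on. *)
- rewrite [X in _ X](_ : _ = \bigcup_i
      (if (i < m)%N then S x i @^-1` [set root] else set0)).
    apply: sigma_algebra_bigcup => i; case: ifP => _;
      last exact: sigma_algebra0.
    by apply: sub_gen_smallest; exists (x, i) => //; exists [set root];
      rewrite ?setTI.
  apply/seteqP; split=> [w [i [im Sw]]|w [i _]]; first by exists i => //;
    rewrite im.
  by case: ifP => // im Sw; exists i.
by rewrite -[P (L x @^-1` _)]/(distribution P (L x) [set m]) (lifetime_law fm).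
Qed.

Lemma probability_root_visitor_le x :
  P (root_visitor L S x) <= \esum_(m in [set: nat])
    (P0 (Xi @^-1` [set m]) * (hit_before R m x)%:E).
Proof.
have mF m : measurable ((L x @^-1` [set m]) `&` visits_root_before (S x) m).
  apply: measurableI; first exact: measurable_lifetime.
  exact: (measurable_visits_root_before (walk_srw fm x)).
have sub : root_visitor L S x `<=`
    \bigcup_m ((L x @^-1` [set m]) `&` visits_root_before (S x) m).
  by move=> w [n [nL Sw]]; exists (L x w) => //; split=> //; exists n.
apply: le_trans (le_measure_countable_cover P
  (measurable_root_visitor L mS x) mF sub) _.
apply: le_esum => m _; rewrite [leLHS]probability_lifetime_visit lee_wpmul2l//.
exact: (visits_root_before_le regG (walk_srw fm x)).
Qed.

(** Exchanging the sums over vertices and lifetimes bounds the expected number of root visitors by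
    the expectation of [g] at [Xi]. By Borel-Cantelli, infinitely many visitors occur only on a null
    set. *)
Lemma transient_of_hit_before (g : nat -> R) : (forall m, (0 <= g m)%R) ->
  (forall m (X : {fset G}), (\sum_(x <- X) hit_before R m x <= g m)%R) ->
  'E_P0[g \o Xi] < +oo -> transient L S.
Proof.
move=> g0 hit_le; rewrite expectation_nat// => Eg.
have [|N [mN N0 subN]] := @borel_cantelli_countable _ _ _ P G
    (root_visitor L S) (measurable_root_visitor L mS).
  (* The sum over all vertices is the supremum of its finite partial sums, to which [hit_le]
     applies. *)
  apply: le_lt_trans Eg; apply: ge_ereal_sup => _ [Y [finY _] <-].
  rewrite fsbig_finite//=.
  apply: le_trans (lee_sum _ (fun x _ => probability_root_visitor_le x)) _.
  rewrite -esum_sum; last by move=> m x _ _;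
    rewrite mule_ge0 ?lee_fin ?hit_before_ge0.
  apply: le_esum => m _; rewrite -ge0_sume_distrr; last first.
    by move=> x _; rewrite lee_fin hit_before_ge0.
  by rewrite lee_wpmul2l// sumEFin lee_fin.
rewrite /transient /recurrent (_ : P _ = 0) ?ltxx//.
apply/eqP; rewrite eq_le measure_ge0 andbT -N0; apply: le_measure;
  rewrite ?inE//.
  exact: measurable_root_hit_infinitely_often.
exact: subset_trans (@root_hit_infinitely_often_sub _ _ _ _ _ _ _) subN.
Qed.

(** For [m > 0] the hypothesis says that [C * g m] dominates [2 m / green m], the bound on the
    summed hitting probabilities; [C] factors out of the expectation. *)
Lemma transient_of_green (g : nat -> R) (C : R) : (0 <= C)%R ->
  (forall m, (0 <= g m)%R) ->
  (forall m, ((m.*2)%:R <= C * g m * green R G m)%R) ->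
  'E_P0[g \o Xi] < +oo -> transient L S.
Proof.
move=> C0 g0 Cg Eg; have Cg0 m : (0 <= C * g m)%R by rewrite mulr_ge0.
apply: (@transient_of_hit_before (fun m => C * g m)%R) => //.
  move=> m X. exact: (sum_hit_before_le X regG (Cg0 m) (Cg m)).
rewrite unlock (eq_integral (fun w => C%:E * (g (Xi w))%:E)) => [|w _].
  rewrite ge0_integralZl_EFin//; last 2 first.
  - by move=> w _; rewrite lee_fin; exact: g0.
  - exact: (measurable_comp_nat Xi (fun m => (g m)%:E)).
  by move: Eg; rewrite unlock => Eg; rewrite lte_mul_pinfty// lee_fin.
by rewrite -EFinM.
Qed.

End Transience.

Lemma tree_regular k (G : rooted_graph) :
  (0 < k)%N -> homogeneous_tree k G -> regular_graph G k.
Proof. by move=> k0 [_ _ regG]. Qed.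

(** With [g m = m] the bound [green m >= 1] suffices; this serves trees and lattices of dimension at
    least 3. *)
Lemma transient_of_expectation (R : realType) (G : rooted_graph)
  (d0 : measure_display) (Om0 : measurableType d0) (P0 : probability Om0 R)
  (Xi : {RV P0 >-> nat})
  (d : measure_display) (Om : measurableType d) (P : probability Om R)
  (L : G -> {RV P >-> nat}) (S : G -> nat -> Om -> G) (k : nat) :
  frog_model Xi L S -> regular_graph G k ->
  ('E_P0[fun w => ((Xi w)%:R : R)%R] < +oo)%E -> transient L S.
Proof.
move=> fm regG; apply: (transient_of_green fm regG (C := 2)) => // m.
have [->|m0] := posnP m; first by rewrite mulr0 mul0r.
by rewrite -mul2n natrM ler_peMr ?mulr_ge0// green_ge1.
Qed.

Unset Implicit Arguments.

Theorem theorem1p13 (R : realType) (G : rooted_graph)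
  (d0 : measure_display) (Om0 : measurableType d0) (P0 : probability Om0 R)
  (Xi : {RV P0 >-> nat})
  (d : measure_display) (Om : measurableType d) (P : probability Om R)
  (L : G -> {RV P >-> nat}) (S : G -> nat -> Om -> G) :
  frog_model Xi L S ->
  [\/ G = Zlattice 1 /\ ('E_P0[fun w => (Num.sqrt (Xi w)%:R : R)%R] < +oo)%E,
      G = Zlattice 2 /\
        ('E_P0[fun w => ((Xi w)%:R / ln (maxn (Xi w) 2)%:R : R)%R] < +oo)%E |
      (exists2 k : nat, (3 <= k)%N &
        homogeneous_tree k G \/ G = Zlattice k) /\
        ('E_P0[fun w => ((Xi w)%:R : R)%R] < +oo)%E] ->
  transient L S.
Proof.
move=> fm [[GE EXi]|[GE EXi]|[[k k3 GE] EXi]].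
(* Multiplying [green_Z1] by [sqrt m] gives [m <= 40 * sqrt m * green m], hence [C = 2 * 40]. *)
- subst G; apply: (transient_of_green fm (lattice_regular 0) (C := 80)
    (g := fun m => Num.sqrt m%:R) _ _ _ EXi) => // m.
  have := ler_wpM2l (sqrtr_ge0 m%:R) (green_Z1 R m).
  rewrite -expr2 sqr_sqrtr// -mul2n natrM => h; lra.
- subst G; have ln_gt0 m : 0 < ln (maxn m 2)%:R :> R.
    by rewrite ln_gt0// ltr1n leq_max orbT.
  (* Here [C = 2 * 200], with 200 from [green_Z2]. *)
  apply: (transient_of_green fm (lattice_regular 1) (C := 400)
    (g := fun m => m%:R / ln (maxn m 2)%:R) _ _ _ EXi) => // m.
    by rewrite divr_ge0// ltW.
  have [->|m0] := posnP m; first by rewrite mul0r mulr0 mul0r.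
  rewrite mulrA -mulrA [_^-1 * _]mulrC mulrA ler_pdivlMr// -mul2n natrM.
  have := ler_wpM2l (ler0n R m) (green_Z2 R m0); lra.
- case: GE => GE.
    by apply: transient_of_expectation fm (tree_regular _ GE) EXi; lia.
  (* The dimension is written as a successor, the form taken by [lattice_regular]. *)
  case: k k3 GE => // k _ GE; subst G.
  exact: transient_of_expectation fm (lattice_regular k) EXi.
Qed.
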